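(* Let $A,B\subseteq\mathbb{Z}$ be finite sets with $|A|=4$ and $|B|\ge 2$. Then $|A\widehat{+}B|=|A|+|B|-3$ if and only if $A=B$ and $A=\{a,c,a+d,c+d\}$ for some integers $a,c,d$.
   Context: For finite sets $A,B\subseteq\mathbb{Z}$, the restricted sumset is $A\widehat{+}B=\{a+b: a\in A,\ b\in B,\ a\neq b\}$. A pair $(A,B)$ with $|A|,|B|\ge 2$ satisfying $|A\widehat{+}B|=|A|+|B|-3$ is called a critical pair; throughout the paper all sets considered have at least two elements. *)

(* Defs.v *)
From HB Require Import structures.
From mathcomp Require Import all_boot all_order all_algebra.
From mathcomp Require Import finmap.

Set Implicit Arguments.
Unset Strict Implicit.
Unset Printing Implicit Defensive.

Import GRing.Theory.
Local Open Scope fset_scope.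
Local Open Scope ring_scope.

Definition restricted_sumset (A B : {fset int}) : {fset int} :=
  [fset a + b | a in A, b in B & a != b].

(* Main.v *)
(** Let [m = min A] and [M = max B].  The sums [m + y] with [y] in [B \ m] and
    [x + M] with [x] in [A \ M] all belong to the restricted sumset and share
    at most the value [m + M], so there are at least [|A| + |B| - 3] of them.
    For a critical pair equality must hold throughout: [m] lies in [B], [M] lies
    in [A], and these sums fill the whole restricted sumset.  Comparing this
    description with the one obtained by exchanging [A] and [B] gives [A = B].
    If now [A = B = {p < q < r < s}], the sum [q + r] must be one of [p + q],
    [p + r], [p + s], [q + s], [r + s], hence [q + r = p + s]. *)
Require Import Defs.
From mathcomp Require Import all_boot all_order all_algebra.
From mathcomp Require Import finmap zify.

Set Implicit Arguments.
Unset Strict Implicit.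
Unset Printing Implicit Defensive.

Local Open Scope fset_scope.
Local Open Scope ring_scope.

Lemma restricted_sumsetP (A B : {fset int}) (z : int) :
  reflect (exists x y : int, [/\ x \in A, y \in B, x != y & z = x + y])
          (z \in restricted_sumset A B).
Proof.
apply: (iffP (imfset2P _ _ _ _ _)) => /=.
  move=> [x xA [y]]; rewrite inE => /andP[yB xy ->].
  by exists x, y.
move=> [x [y [xA yB xy ->]]]; exists x => //; exists y => //.
by rewrite inE; apply/andP; split.
Qed.

Lemma restricted_sumsetC (A B : {fset int}) :
  restricted_sumset A B = restricted_sumset B A.
Proof.
by apply/fsetP => z; apply/restricted_sumsetP/restricted_sumsetP;
  move=> [x [y [xA yB xy ->]]]; exists y, x; split=> //; lia.
Qed.

Lemma fset_min_exists (A : {fset int}) : A != fset0 ->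
  exists2 m, m \in A & forall x, x \in A -> m <= x.
Proof.
case/fset0Pn=> x0 x0A.
have [m _ mP] := Order.TotalTheory.arg_minP (fun x : A => val x)
  (erefl : xpredT [` x0A]).
by exists (val m); [exact: valP | move=> x xA; apply: (mP [` xA])].
Qed.

Lemma fset_max_exists (A : {fset int}) : A != fset0 ->
  exists2 m, m \in A & forall x, x \in A -> x <= m.
Proof.
case/fset0Pn=> x0 x0A.
have [m _ mP] := Order.TotalTheory.arg_maxP (fun x : A => val x)
  (erefl : xpredT [` x0A]).
by exists (val m); [exact: valP | move=> x xA; apply: (mP [` xA])].
Qed.

Lemma critical_extremal_sums (A B : {fset int}) (m M : int) :
    m \in A -> (forall x, x \in A -> m <= x) ->
    M \in B -> (forall y, y \in B -> y <= M) ->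
    (#|` restricted_sumset A B| + 3 <= #|` A| + #|` B|)%N ->
  [/\ m \in B, M \in A &
      restricted_sumset A B =
      ([fset m + y | y in B `\ m] : {fset int}) `|`
      ([fset x + M | x in A `\ M] : {fset int}) ].
Proof.
move=> mA mP MB MP hS.
set S := restricted_sumset A B; rewrite -/S in hS.
set P1 : {fset int} := [fset m + y | y in B `\ m].
set P2 : {fset int} := [fset x + M | x in A `\ M].
have c1 : #|` P1| = #|` B `\ m| by rewrite card_imfset //=; move=> x y; lia.
have c2 : #|` P2| = #|` A `\ M| by rewrite card_imfset //=; move=> x y; lia.
have cB := cardfsD1 m B; have cA := cardfsD1 M A.
(* If [m + y = x + M] with [m <= x] and [y <= M], then [x = m] and [y = M]. *)
have cI : (#|` P1 `&` P2| <= 1)%N.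
  rewrite -(cardfs1 (m + M)); apply/fsubset_leq_card/fsubsetP => z.
  rewrite !inE => /andP[/imfsetP[y /= + ->] /imfsetP[x /=]].
  rewrite !inE => /andP[_ yB] /andP[_ xA].
  by have := mP _ xA; have := MP _ yB; lia.
have cU := cardfsUI P1 P2.
have sub : P1 `|` P2 `<=` S.
  apply/fsubsetP => z; rewrite inE => /orP[] /imfsetP[w /=].
    rewrite !inE => /andP[wm wB] ->.
    by apply/restricted_sumsetP; exists m, w; split=> //; lia.
  rewrite !inE => /andP[wM wA] ->.
  by apply/restricted_sumsetP; exists w, M; split.
have cS := fsubset_leq_card sub.
(* By inclusion-exclusion, the union of [P1] and [P2] has at least [|A| + |B| - 3] elements, and one
   more for each of [m \in B], [M \in A] that fails. The bound [hS] leaves no room for a failure,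
   nor for an element of [S] outside the union. *)
split.
- by case: (m \in B) cB => // cB; lia.
- by case: (M \in A) cA => // cA; lia.
- apply/eqP; rewrite eq_sym eqEfcard sub andTb.
  have := leq_b1 (m \in B); have := leq_b1 (M \in A); lia.
Qed.

Lemma critical_pair_eq (A B : {fset int}) :
    A != fset0 -> B != fset0 ->
    (#|` restricted_sumset A B| + 3 <= #|` A| + #|` B|)%N ->
  A = B.
Proof.
wlog suff sub : A B / A != fset0 -> B != fset0 ->
    (#|` restricted_sumset A B| + 3 <= #|` A| + #|` B|)%N -> B `<=` A.
  move=> A0 B0 hS; apply/eqP; rewrite eqEfsubset (sub A B) // andbT.
  apply: (sub B A) => //.
  by rewrite restricted_sumsetC [X in (_ <= X)%N]addnC.
move=> A0 B0 hS.
have [m mA mP] := fset_min_exists A0; have [M MB MP] := fset_max_exists B0.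
have [m' mB' mP'] := fset_min_exists B0; have [M' MA' MP'] := fset_max_exists A0.
have [mB MA eS] := critical_extremal_sums mA mP MB MP hS.
have [|m'A M'B eS'] := critical_extremal_sums mB' mP' MA' MP' _.
  by rewrite restricted_sumsetC [X in (_ <= X)%N]addnC.
(* Each set contains the minimum and the maximum of the other, so these extremes agree. *)
have em : m' = m by have := mP _ m'A; have := mP' _ mB; lia.
have eM : M' = M by have := MP _ M'B; have := MP' _ MA; lia.
subst m' M'.
apply/fsubsetP => y yB.
have [->|ym] := eqVneq y m; first by [].
have [->|yM] := eqVneq y M; first by [].
(* In the exchanged description, [m + y] is either [m + w] with [w] in [A], so [y = w], or [w + M]
   with [w >= m], which is too large since [y < M]. *)
have : m + y \in restricted_sumset B A.
  by apply/restricted_sumsetP; exists y, m; split=> //; lia.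
rewrite eS' inE => /orP[] /imfsetP[w /=]; rewrite !inE => /andP[_ wAB] e.
  by have -> : y = w by lia.
by have := mP' _ wAB; have := MP _ yB; lia.
Qed.

Lemma fset4_sorted (A : {fset int}) : #|` A| = 4%N ->
  exists p q r s : int, [/\ p < q, q < r, r < s & A = [fset p; q; r; s] ].
Proof.
move=> hA.
have := Order.TotalTheory.sort_lt_sorted (enum_fset A); rewrite fset_uniq.
have := mem_sort <=%O (enum_fset A).
have : size (sort <=%O (enum_fset A)) = 4%N by rewrite size_sort.
case: (sort _ _) => [|p [|q [|r [|s [|]]]]] //= _ mem /and4P[pq qr rs _].
exists p, q, r, s; split=> //; apply/fsetP => x.
by have := mem x; rewrite !inE -!orbA => ->.
Qed.

Lemma fset4_uniq (K : choiceType) (a b c d : K) :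
  #|` [fset a; b; c; d] | = 4%N -> uniq [:: a; b; c; d].
Proof.
have -> : #|` [fset a; b; c; d] | = size (undup [:: a; b; c; d]).
  rewrite -card_fseq; congr size; congr enum_fset.
  by apply/fsetP => x; rewrite !inE /= -!orbA orbF.
move=> h.
(* A repetition would make [undup] strictly shorter than the list. *)
by have := ltn_size_undup [:: a; b; c; d]; rewrite h ltnn => /esym/negbFE.
Qed.

(** Of the six sums of two distinct elements, [a + (c + d)] and [c + (a + d)] coincide; any further
    coincidence would force two of the four elements to be equal. *)
Lemma card_restricted_sumset_additive_quadruple (a c d : int) :
  uniq [:: a; c; a + d; c + d] ->
  #|` restricted_sumset [fset a; c; a + d; c + d]
                       [fset a; c; a + d; c + d] | = 5%N.
Proof.
rewrite /= !inE => u.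
set s : seq int := [:: a + c; a + (a + d); a + (c + d); c + (c + d); (a + d) + (c + d)].
have us : uniq s by rewrite /s /= !inE; lia.
set Q := [fset a; c; a + d; c + d].
suff -> : restricted_sumset Q Q = [fset x in s] :> {fset int}.
  by rewrite card_fseq undup_id.
apply/fsetP => z; rewrite /s !inE orbF.
apply/restricted_sumsetP/idP.
  move=> [x [y [+ + xy ->]]]; rewrite !inE; lia.
move=> /or4P[/eqP->|/eqP->|/eqP->|/orP[]/eqP->].
- by exists a, c; split; rewrite ?inE ?eqxx ?orbT //; lia.
- by exists a, (a + d); split; rewrite ?inE ?eqxx ?orbT //; lia.
- by exists a, (c + d); split; rewrite ?inE ?eqxx ?orbT //; lia.
- by exists c, (c + d); split; rewrite ?inE ?eqxx ?orbT //; lia.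
- by exists (a + d), (c + d); split; rewrite ?inE ?eqxx ?orbT //; lia.
Qed.

Theorem theorem3 (A B : {fset int})
    (hA : #|` A| = 4%N) (hB : (2 <= #|` B|)%N) :
  #|` restricted_sumset A B| = (#|` A| + #|` B| - 3)%N <->
  A = B /\ exists a c d : int, A = [fset a; c; a + d; c + d].
Proof.
split=> [hS | [<- [a [c [d eA]]]]]; last first.
  rewrite hA eA card_restricted_sumset_additive_quadruple //.
  by apply: fset4_uniq; rewrite -eA.
have hS3 : (#|` restricted_sumset A B| + 3 <= #|` A| + #|` B|)%N by lia.
have eAB : A = B.
  by apply: critical_pair_eq => //; rewrite -cardfs_gt0; lia.
split=> //; subst B.
have [p [q [r [s [pq qr rs eA]]]]] := fset4_sorted hA.
have pA : p \in A by rewrite eA !inE eqxx.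
have sA : s \in A by rewrite eA !inE eqxx !orbT.
have pP x : x \in A -> p <= x by rewrite eA !inE; lia.
have sP x : x \in A -> x <= s by rewrite eA !inE; lia.
have [_ _ eS] := critical_extremal_sums pA pP sA sP hS3.
have : q + r \in restricted_sumset A A.
  apply/restricted_sumsetP; exists q, r.
  by split; rewrite ?eA ?inE ?eqxx ?orbT //; lia.
rewrite eS inE => qrS.
(* The sum [q + r] exceeds [p + q] and [p + r] and lies below [q + s] and [r + s]. *)
have qrps : q + r = p + s.
  by case/orP: qrS => /imfsetP[w /=]; rewrite eA !inE; lia.
(* With [d = r - p], the relation [qrps] reads [s = q + d]. *)
exists p, q, (r - p); rewrite eA.
by have [-> ->] : p + (r - p) = r /\ q + (r - p) = s by lia.
Qed.
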